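(* Let $V_1,V_2,V_3,W_1,W_2,W_3$ be finite-dimensional complex vector spaces, and let $s\in V_1\otimes V_2^*\otimes V_3$ and $t\in W_1\otimes W_2^*\otimes W_3$. Let $\lambda,\mu$ be partitions of length at most $\dim V_2$ such that $\mu$ is obtained from $\lambda$ by adding one box to its Young diagram, and let $\kappa,\nu$ be partitions of length at most $\dim W_2$ such that $\nu$ is obtained from $\kappa$ by adding one box. Then the border rank of the 6-tensor $s\otimes t\in V_1\otimes V_2^*\otimes V_3\otimes W_1\otimes W_2^*\otimes W_3$ satisfies \[ \underline{\mathrm{R}}(s\otimes t)\ \ge\ \frac{\mathrm{R}(F_{\mu,\lambda}(s))}{\max_{v_2\in V_2^*} \mathrm{R}(\phi_{\mu,\lambda}(v_2))}\cdot\frac{\mathrm{R}(F_{\nu,\kappa}(t))}{\max_{w_2\in W_2^*} \mathrm{R}(\phi_{\nu,\kappa}(w_2))}. \]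
   Context: All spaces are over $\mathbb{C}$. The tensor rank $\mathrm{R}(t)$ of $t\in U_1\otimes\cdots\otimes U_k$ is the smallest $r$ such that $t$ is a sum of $r$ simple tensors; for an element of a tensor product of two spaces this is matrix rank. The border rank $\underline{\mathrm{R}}(t)$ is the smallest $r$ such that $t$ is a limit (Euclidean topology) of tensors in $U_1\otimes\cdots\otimes U_k$ of rank at most $r$. The product $s\otimes t$ is a 6-tensor (no factors are grouped). Pieri maps: for a finite-dimensional complex vector space $V$ and a partition $\lambda$ of length at most $\dim V$, $S_\lambda V$ is the irreducible $\mathrm{GL}_V$-module of type $\lambda$. The Pieri rule gives a $\mathrm{GL}_V$-decomposition $V\otimes S_\lambda V\cong\bigoplus_\mu S_\mu V$ over partitions $\mu$ of length at most $\dim V$ obtained from $\lambda$ by adding a box. For each such $\mu$ there is a $\mathrm{GL}_V$-equivariant embedding $S_\mu V\hookrightarrow V\otimes S_\lambda V$, unique up to nonzero scaling. It corresponds (by dualising) to a nonzero $\mathrm{GL}_V$-equivariant linear map $\phi_{\mu,\lambda}:V^*\to S_\mu V^*\otimes S_\lambda V$ where $S_\mu V^*\cong (S_\mu V)^*$. For $v\in V^*$, $\mathrm{R}(\phi_{\mu,\lambda}(v))$ is the rank of $\phi_{\mu,\lambda}(v)$ as an element of the two-factor tensor product $S_\mu V^*\otimes S_\lambda V$. Young flattening: $F_{\mu,\lambda}$ is the linear map on $V_1\otimes V_2^*\otimes V_3$ obtained by applying $\phi_{\mu,\lambda}$ (with $V=V_2$) to the middle factor, $V_1\otimes V_2^*\otimes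 V_3\to V_1\otimes S_\mu V_2^*\otimes S_\lambda V_2\otimes V_3$, and then grouping into a matrix in $(V_1\otimes S_\mu V_2^* )\otimes(S_\lambda V_2\otimes V_3)$. The map $F_{\nu,\kappa}$ on $W_1\otimes W_2^*\otimes W_3$ is defined in the same way using $\phi_{\nu,\kappa}$ with $V=W_2$. *)

(* Defs.v *)
From HB Require Import structures.
From mathcomp Require Import all_boot all_order all_algebra all_fingroup.
From mathcomp Require Import boolp classical_sets reals topology normedtype.
From mathcomp Require Import complex.

Set Implicit Arguments.
Unset Strict Implicit.
Unset Printing Implicit Defensive.

Import GRing.Theory Num.Theory.
Import numFieldNormedType.Exports.

Local Open Scope ring_scope.
Local Open Scope classical_set_scope.

(* Least and greatest element of a set of naturals (0 if there is none). *)
Definition least (P : set nat) : nat :=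
  xget 0%N [set n | P n /\ forall m, P m -> (n <= m)%N].

Definition greatest (P : set nat) : nat :=
  xget 0%N [set n | P n /\ forall m, P m -> (m <= n)%N].

(* The tensor product of a finite family of spaces, realised by arrays of
   coordinates in the product of the reference bases [vbasis {:U i}]: the entry
   of a tensor at x is its coefficient on the tensor product of the
   [basis_tuple x i].  All maps out of it are given by [tlift], the extension by
   linearity of a function that is multilinear in the factors. *)
Section Tensor.
Variables (K : numFieldType) (I : finType).
Implicit Types (U : I -> vectType K) (X : vectType K).

Definition tensor_index U : finType := {dffun forall i : I, 'I_(\dim {:U i})}.

Definition tensor U : vectType K := {ffun tensor_index U -> K^o}.

Definition entry U (t : tensor U) (x : tensor_index U) : K :=
  (t : {ffun tensor_index U -> K^o}) x.

Definition basis_tuple U (x : tensor_index U) (i : I) : U i :=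
  (vbasis {:U i})`_(x i).

Definition pure U (u : forall i, U i) : tensor U :=
  ([ffun x : tensor_index U => \prod_i coord (vbasis {:U i}) (x i) (u i)]
     : {ffun tensor_index U -> K^o}).

Definition tlift U X (f : (forall i, U i) -> X) : 'Hom(tensor U, X) :=
  linfun (fun t : tensor U => \sum_x entry t x *: f (basis_tuple x)).

Definition tensor_rank U (t : tensor U) : nat :=
  least [set r | exists u : 'I_r -> forall i, U i, t = \sum_(k < r) pure (u k)].

(* Convergence of every entry, in the topology of the modulus of K, is convergence
   in the Euclidean topology of the finite-dimensional space [tensor U]. *)
Definition border_rank U (t : tensor U) : nat :=
  least [set r | exists T : nat -> tensor U,
    (forall n, (tensor_rank (T n) <= r)%N) /\
    forall x, entry (T n) x @[n --> \oo] --> entry t x].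

End Tensor.

Section Products.
Variable K : numFieldType.
Implicit Types U V W X Y : vectType K.

Definition fam2 U W (b : bool) : vectType K := if b then W else U.

Definition tens2 U W : vectType K := tensor (fam2 U W).

Definition pure2 U W (u : U) (w : W) : tens2 U W :=
  pure (fun b => if b return fam2 U W b then w else u).

Definition tlift2 U W X (f : U -> W -> X) : 'Hom(tens2 U W, X) :=
  tlift (fun u : forall b, fam2 U W b => f (u false) (u true)).

Definition fam3 U V W (i : 'I_3) : vectType K :=
  match val i with 0%N => U | 1%N => V | _ => W end.

Definition tens3 U V W : vectType K := tensor (fam3 U V W).

Definition tlift3 U V W X (f : U -> V -> W -> X) : 'Hom(tens3 U V W, X) :=
  tlift (fun u : forall i, fam3 U V W i =>
    f (u (@Ordinal 3 0 isT)) (u (@Ordinal 3 1 isT)) (u (@Ordinal 3 2 isT))).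

(* The product of an I-indexed and a J-indexed tensor is indexed by I + J: no
   factors are grouped. *)
Definition fam_cat (I J : finType) (U : I -> vectType K) (W : J -> vectType K)
  (k : I + J) : vectType K := match k with inl i => U i | inr j => W j end.

Definition tprod (I J : finType) (U : I -> vectType K) (W : J -> vectType K)
    (s : tensor U) (t : tensor W) : tensor (fam_cat U W) :=
  tlift (fun u : forall i, U i =>
    tlift (fun w : forall j, W j =>
      pure (fun k => match k return fam_cat U W k with
                     | inl i => u i
                     | inr j => w j
                     end)) t) s.

Definition dual V : vectType K := 'Hom(V, K^o).

(* The canonical isomorphism from Hom(X, Y) to X^* (x) Y. *)
Definition hom_tensor X Y (f : 'Hom(X, Y)) : tens2 (dual X) Y :=
  \sum_i pure2 (linfun (coord (vbasis {:X}) i) : dual X) (f (vbasis {:X})`_i).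

End Products.

Definition is_partition (la : seq nat) : Prop :=
  sorted geq la /\ 0%N \notin la.

Definition add_box (la mu : seq nat) : Prop := exists i, mu = incr_nth la i.

(* The Schur module S_la V is the image of the Young symmetrizer on the d-th
   tensor power of V, d = |la|.  The boxes of la are numbered 0, .., d-1 row by
   row, so that box k lies in row [reshape_index la k] and in column
   [reshape_offset la k]; permutations act on V^(x)d by permuting the places. *)
Section Schur.
Variables (K : numFieldType) (V : vectType K) (la : seq nat).
Let d := sumn la.

Definition tpow : vectType K := tensor (fun _ : 'I_d => V).

Definition place_act (p : 'S_d) : 'End(tpow) :=
  tlift (fun u : 'I_d -> V => pure (fun i => u (p i)) : tpow).

Definition row_stab : {set 'S_d} :=
  [set p : 'S_d | [forall k : 'I_d, reshape_index la (p k) == reshape_index la k]].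

Definition col_stab : {set 'S_d} :=
  [set p : 'S_d | [forall k : 'I_d, reshape_offset la (p k) == reshape_offset la k]].

Definition young_symmetrizer : 'End(tpow) :=
  ((\sum_(q in col_stab) (-1) ^+ q *: place_act q)
     \o (\sum_(p in row_stab) place_act p))%VF.

Definition schur : vectType K := subvs_of (limg young_symmetrizer).

Definition tpow_act (g : 'End(V)) : 'End(tpow) :=
  tlift (fun u : 'I_d -> V => pure (fun i => g (u i)) : tpow).

(* [tpow_act g] commutes with [young_symmetrizer], hence preserves its image;
   [vsproj] only restricts the codomain. *)
Definition schur_act (g : 'End(V)) : 'End(schur) :=
  linfun (fun x : schur =>
    vsproj (limg young_symmetrizer) (tpow_act g (vsval x))).

End Schur.

Section Pieri.
Variables (K : numFieldType) (V : vectType K) (la mu : seq nat).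

Definition pieri_embedding (iota : 'Hom(schur V mu, tens2 V (schur V la))) : Prop :=
  (lker iota == 0)%VS /\
  forall g : 'End(V), (lker g == 0)%VS -> forall x,
    iota (schur_act mu g x) =
    tlift2 (fun v y => pure2 (g v) (schur_act la g y)) (iota x).

Definition contract (S : vectType K) (v : dual V) : 'Hom(tens2 V S, S) :=
  tlift2 (fun x y => (v : 'Hom(V, K^o)) x *: y).

(* An embedding iota of S_mu V in V (x) S_la V is dualised to the map sending v
   in V^* to the element of (S_mu V)^* (x) S_la V corresponding to the linear
   map (v (x) id) o iota. *)
Definition pieri_map (iota : 'Hom(schur V mu, tens2 V (schur V la))) (v : dual V)
    : tens2 (dual (schur V mu)) (schur V la) :=
  hom_tensor (contract (schur V la) v \o iota)%VF.

End Pieri.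

Definition young_flattening (K : numFieldType) (V1 V2 V3 A B : vectType K)
    (phi : V2 -> tens2 A B) : 'Hom(tens3 V1 V2 V3, tens2 (tens2 V1 A) (tens2 B V3)) :=
  tlift3 (fun (v1 : V1) (v2 : V2) (v3 : V3) =>
    tlift2 (fun a b => pure2 (pure2 v1 a) (pure2 b v3)) (phi v2)).

(* Main.v *)
From HB Require Import structures.
Require Import Defs.
From mathcomp Require Import all_boot all_order all_algebra.
From mathcomp Require Import boolp classical_sets reals topology normedtype.
From mathcomp Require Import complex mxtens.

(** Read a Young flattening as a matrix, and let [L] and [L'] be the two linear
    maps from tensors to matrices obtained in this way from [phi] and [psi].  The
    argument uses three facts.

    - [L] has small rank on simple tensors: since [phi] is linear
      ([pieri_map_linear]), the flattening of v1 (x) v2 (x) v3 is [phi v2] with the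
      vectors v1 and v3 carried along, so its rank is at most that of [phi v2],
      hence at most the maximum a of these ranks ([tensor_rank_flattening],
      [tensor_rank_le_greatest]).  Likewise [L'] has rank at most b on simple
      tensors.
    - The Kronecker product L (x) L' is a linear map [kron_map L L'] defined on
      the whole space of product tensors, with no grouping of factors, and rank
      is multiplicative under Kronecker products ([mxrank_tens]).  It sends
      s (x) t to a matrix of rank rank (L s) * rank (L' t), and a simple tensor
      to a matrix of rank at most a * b ([kron_mapE], [entry_pure_cat]).
    - Matrix rank is lower semicontinuous ([mxrank_lim]): a bound on the rank of
      every matrix of a convergent sequence also bounds the rank of the limit.

    If s (x) t is a limit of tensors of rank at most r, then [kron_map L L'] sends
    these tensors to matrices of rank at most r * (a * b), and therefore
    rank (L s) * rank (L' t) <= r * (a * b) ([border_rank_tprod]).  Dividing by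
    a * b gives the inequality; when a * b = 0 its left side is 0, the inverse of 0
    being 0. *)

Set Implicit Arguments.
Unset Strict Implicit.
Unset Printing Implicit Defensive.

Import Order.TTheory GRing.Theory Num.Theory.
Import numFieldNormedType.Exports.

Local Open Scope ring_scope.
Local Open Scope classical_set_scope.

(** * Extremal elements of sets of naturals *)

Lemma least_ex (P : set nat) : (exists n, P n) ->
  P (least P) /\ forall m, P m -> (least P <= m)%N.
Proof.
move=> exP; have ex' : exists n, `[<P n>] by case: exP => n Pn; exists n; apply/asboolP.
apply: (xgetPex 0%N (P := [set n | P n /\ forall m, P m -> (n <= m)%N])).
case: (ex_minnP ex') => m /asboolP Pm m_min; exists m; split => // k Pk.
by apply: m_min; apply/asboolP.
Qed.

Lemma greatest_ge (P : set nat) b n : (forall m, P m -> (m <= b)%N) ->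
  P n -> (n <= greatest P)%N.
Proof.
move=> ub Pn; have ex' : exists n, `[<P n>] by exists n; apply/asboolP.
have ub' m : `[<P m>] -> (m <= b)%N by move/asboolP/ub.
have: [set n | P n /\ forall m, P m -> (m <= n)%N] (greatest P).
  apply: xgetPex; case: (ex_maxnP ex' ub') => m /asboolP Pm m_max.
  by exists m; split => // k Pk; apply: m_max; apply/asboolP.
by case=> _; exact.
Qed.

(** * Multilinear maps and the universal property of tensors *)

Section Multilinear.
Variable K : numFieldType.

(** Turns a proof that a function is linear into a bundled linear map, to which the
    theory of morphisms applies. *)
Lemma linear_packed (V X : lmodType K) (h : V -> X) :
  linear h -> exists H : {linear V -> X}, h = H.
Proof.
move=> h_lin; pose F := GRing.isLinear.Build _ _ _ _ _ h_lin.
by exists (HB.pack_for {linear V -> X} h F).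
Qed.

Lemma coord_vbasisE (V : vectType K) (i j : 'I_(\dim {:V})) :
  coord (vbasis {:V}) i (vbasis {:V})`_j = (i == j)%:R.
Proof. by rewrite coord_free ?(basis_free (vbasisP _)) // eq_sym. Qed.

Lemma vbasis_sum (V : vectType K) (v : V) :
  v = \sum_i coord (vbasis {:V}) i v *: (vbasis {:V})`_i.
Proof. exact/coord_vbasis/memvf. Qed.

Variable I : finType.
Implicit Types (U : I -> vectType K) (X : vectType K).

Definition multilinear U X (f : (forall i, U i) -> X) :=
  forall u i, linear (fun v : U i => f (dfwith u v)).

Lemma entry_lin U a (s t : tensor U) x :
  entry (a *: s + t) x = a * entry s x + entry t x.
Proof. by rewrite /entry !ffunE. Qed.

Lemma entry_sum U J (r : seq J) (P : pred J) (F : J -> tensor U) x :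
  entry (\sum_(j <- r | P j) F j) x = \sum_(j <- r | P j) entry (F j) x.
Proof. by rewrite /entry sum_ffunE. Qed.

Lemma tliftE U X (f : (forall i, U i) -> X) t :
  tlift f t = \sum_x entry t x *: f (basis_tuple x).
Proof.
have f_linear : linear (fun t : tensor U => \sum_x entry t x *: f (basis_tuple x)).
  move=> a r r'; rewrite scaler_sumr -big_split /=; apply: eq_bigr => x _.
  by rewrite entry_lin scalerDl scalerA.
by have [F FE] := linear_packed f_linear; rewrite /tlift FE lfunE -FE.
Qed.

Lemma entry_pure U (u : forall i, U i) x :
  entry (pure u) x = \prod_i coord (vbasis {:U i}) (x i) (u i).
Proof. by rewrite /entry ffunE. Qed.

Lemma entry_pure_basis U (x y : tensor_index U) :
  entry (pure (basis_tuple x)) y = (x == y)%:R.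
Proof.
rewrite entry_pure; have [->|neq] := eqVneq x y.
  by rewrite big1 // => i _; rewrite coord_vbasisE eqxx.
have /existsP[i neqi] : [exists i, x i != y i].
  apply: contraR neq => /existsPn eqxy; apply/eqP/ffunP => i.
  by apply/eqP/negPn/eqxy.
by rewrite (bigD1 i) //= coord_vbasisE eq_sym (negbTE neqi) mul0r.
Qed.

Lemma tensor_basis U (t : tensor U) : t = \sum_x entry t x *: pure (basis_tuple x).
Proof.
apply/ffunP => y; rewrite sum_ffunE (bigD1 y) //= big1 ?addr0 => [|x neq].
  by rewrite ffunE -[pure _ y]/(entry _ y) entry_pure_basis eqxx /GRing.scale /= mulr1.
by rewrite ffunE -[pure _ y]/(entry _ y) entry_pure_basis (negbTE neq) scaler0.
Qed.

Lemma multilinear_pure U : multilinear (@pure K I U).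
Proof.
move=> u i a v w; apply/ffunP => x; rewrite !ffunE /=.
rewrite !(bigD1 i (P:=xpredT)) //= !dfwith_in linearP /= mulrDl -mulrA.
rewrite /GRing.scale /=.
by congr (a * (_ * _) + _ * _); apply: eq_bigr => j neq; rewrite !dfwith_out // eq_sym.
Qed.

(** The factors are replaced by basis vectors one at a time: the induction is on a
    list [s] of the places at which [u] is not yet known to be a basis vector. *)
Lemma multilinear_eq U X (f g : (forall i, U i) -> X) :
  multilinear f -> multilinear g ->
  (forall x, f (basis_tuple x) = g (basis_tuple x)) -> f =1 g.
Proof.
move=> f_lin g_lin eq_basis.
suff agree (s : seq I) u :
    (forall i, i \notin s -> exists j : 'I_(\dim {:U i}), u i = (vbasis {:U i})`_j) ->
    f u = g u.
  by move=> u; apply: (agree (enum I)) => i; rewrite mem_enum.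
elim: s u => [|i s IHs] u u_basis.
  have [c uc] := fin_all_exists (fun i => u_basis i isT).
  have -> : u = basis_tuple ([ffun i => c i] : tensor_index U).
    by apply: functional_extensionality_dep => i; rewrite /basis_tuple ffunE.
  exact: eq_basis.
have u_upd : u = dfwith u (u i).
  by apply: functional_extensionality_dep => j; case: dfwithP.
have lin_sum (h : (forall i, U i) -> X) : multilinear h ->
    h u = \sum_j coord (vbasis {:U i}) j (u i) *: h (dfwith u (vbasis {:U i})`_j).
  move=> h_lin; have [H HE] := linear_packed (h_lin u i).
  have {}HE v : h (dfwith u v) = H v by rewrite -HE.
  rewrite {1}u_upd HE {1}[u i]vbasis_sum linear_sum.
  by apply: eq_bigr => j _; rewrite linearZ HE.
rewrite !lin_sum //; apply: eq_bigr => j _; congr (_ *: _); apply: IHs => k ks.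
case: dfwithP ks => [|k' neq] ks; first by exists j.
by apply: u_basis; rewrite inE negb_or eq_sym neq.
Qed.

(** The universal property of the tensor product.  It needs multilinearity of [f]
    because [tlift f] only sees the values of [f] on basis vectors. *)
Lemma tlift_pure U X (f : (forall i, U i) -> X) u :
  multilinear f -> tlift f (pure u) = f u.
Proof.
move=> f_lin; apply: (multilinear_eq (f := fun u => tlift f (pure u))) => // [v i a w w'|x].
  by rewrite multilinear_pure linearP.
rewrite tliftE (bigD1 x) //= big1 ?addr0 ?entry_pure_basis ?eqxx ?scale1r //.
by move=> y neq; rewrite entry_pure_basis eq_sym (negbTE neq) scale0r.
Qed.

(** The constant of a simple tensor is absorbed by one of its factors, so [I] has to
    be inhabited: over the empty family 1 is the only simple tensor. *)
Lemma scale_pure U i0 c (u : forall i, U i) :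
  c *: pure u = pure (dfwith u (c *: u i0)).
Proof.
have [H HE] := linear_packed (multilinear_pure u (i := i0)).
rewrite [RHS](congr1 (@^~ _) HE) linearZ -[in RHS]HE.
congr (_ *: pure _).
by apply: functional_extensionality_dep => j; case: dfwithP.
Qed.

Lemma tlift_linear U X a (f g h : (forall i, U i) -> X) t :
  (forall u, h u = a *: f u + g u) -> tlift h t = a *: tlift f t + tlift g t.
Proof.
move=> hE; rewrite !tliftE scaler_sumr -big_split; apply: eq_bigr => x _.
by rewrite hE scalerDr !scalerA mulrC.
Qed.

End Multilinear.

(** * Tensor rank and border rank *)

Section TensorRank.
Variables (K : numFieldType) (I : finType).
Implicit Types (U : I -> vectType K).

Definition has_length U (t : tensor U) r :=
  exists u : 'I_r -> forall i, U i, t = \sum_(k < r) pure (u k).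

Lemma has_length_card U (i0 : I) (t : tensor U) :
  has_length t #|tensor_index U|.
Proof.
exists (fun k => let x := enum_val k in
  dfwith (basis_tuple x) (entry t x *: basis_tuple x i0)).
rewrite {1}[t]tensor_basis (reindex _ (onW_bij _ (enum_val_bij _))) /=.
by apply: eq_bigr => k _; rewrite -scale_pure.
Qed.

Lemma tensor_rankP U (i0 : I) (t : tensor U) : has_length t (tensor_rank t).
Proof.
have [|//] := @least_ex [set r | has_length t r].
by exists #|tensor_index U|; exact: has_length_card.
Qed.

Lemma tensor_rank_le U (t : tensor U) r : has_length t r -> (tensor_rank t <= r)%N.
Proof.
by move=> tr; have [|_] := @least_ex [set r | has_length t r]; [exists r | apply].
Qed.

Lemma border_rankP U (t : tensor U) : exists T : nat -> tensor U,
  (forall n, (tensor_rank (T n) <= border_rank t)%N) /\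
  forall x, entry (T n) x @[n --> \oo] --> entry t x.
Proof.
have [|//] := @least_ex [set r | exists T : nat -> tensor U,
    (forall n, (tensor_rank (T n) <= r)%N) /\
    forall x, entry (T n) x @[n --> \oo] --> entry t x].
by exists (tensor_rank t), (fun=> t); split=> // x; exact: cvg_cst.
Qed.

End TensorRank.

(** * Matrix rank: Kronecker products and limits *)

Section MatrixRank.
Variable K : numFieldType.

(** One-sided inverses of the two factors of a rank factorisation reduce [A] to an
    identity matrix.  As an equation between products, this carries lower bounds on
    rank through Kronecker products and limits. *)
Lemma mxrank_id m n (A : 'M[K]_(m, n)) :
  exists P Q, P *m A *m Q = 1%:M :> 'M_(\rank A).
Proof.
have /row_fullP[P PA] := col_base_full A.
have /row_freeP[Q AQ] := row_base_free A.
exists P, Q; transitivity (P *m (col_base A *m row_base A) *m Q).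
  by rewrite mulmx_base.
by rewrite (mulmxA P) PA mul1mx.
Qed.

(** The rank factorisations of [A] and [B] multiply to one of [A *t B], which bounds
    its rank from above; the reductions of [A] and [B] to identity matrices multiply
    to one of [A *t B], which bounds it from below. *)
Lemma mxrank_tens m n p q (A : 'M[K]_(m, n)) (B : 'M[K]_(p, q)) :
  \rank (A *t B) = (\rank A * \rank B)%N.
Proof.
apply/eqP; rewrite eqn_leq; apply/andP; split.
  by rewrite -{1}(mulmx_base A) -{1}(mulmx_base B) -tensmx_mul mulmx_max_rank.
have [P [Q PAQ]] := mxrank_id A; have [P' [Q' PBQ']] := mxrank_id B.
have tens1 : (P *t P') *m (A *t B) *m (Q *t Q') = 1%:M.
  rewrite !tensmx_mul PAQ PBQ'; apply/matrixP => i j.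
  case: (mxtens_indexP i) => i0 i1; case: (mxtens_indexP j) => j0 j1.
  rewrite tensmxE !mxE (can_eq (@mxtens_indexK _ _)) xpair_eqE.
  by rewrite -natrM mulnb.
by rewrite -{1}(mxrank1 K (\rank A * \rank B)) -tens1
  (leq_trans (mxrankM_maxl _ _)) ?mxrankM_maxr.
Qed.

Lemma cvg_det n (A : nat -> 'M[K]_n) (B : 'M[K]_n) :
  (forall i j, A k i j @[k --> \oo] --> B i j) ->
  \det (A k) @[k --> \oo] --> \det B.
Proof.
move=> AB; rewrite /determinant.
apply: (cvg_big (op := +%R)) => [|s _]; first exact: add_continuous.
apply: cvgM; first exact: cvg_cst.
by apply: (@cvg_big K _ *%R) => [|i _]; [exact: mul_continuous | exact: AB].
Qed.

Lemma cvg_mulmx m n p (A : nat -> 'M[K]_(m, n)) (C : nat -> 'M[K]_(n, p))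
    (B : 'M[K]_(m, n)) (D : 'M[K]_(n, p)) :
  (forall i j, A k i j @[k --> \oo] --> B i j) ->
  (forall i j, C k i j @[k --> \oo] --> D i j) ->
  forall i j, (A k *m C k) i j @[k --> \oo] --> (B *m D) i j.
Proof.
move=> AB CD i j; rewrite mxE; under eq_cvg do rewrite mxE.
apply: (cvg_big (op := +%R)) => [|l _]; first exact: add_continuous.
by apply: cvgM; [exact: AB | exact: CD].
Qed.

(** Lower semicontinuity of rank.  If [B] had rank larger than [r], fixed matrices
    [P] and [Q] would reduce it to an identity matrix of size larger than [r]; then
    all the determinants of P A_k Q vanish while their limit is 1. *)
Lemma mxrank_lim m n (A : nat -> 'M[K]_(m, n)) (B : 'M[K]_(m, n)) r :
  (forall i j, A k i j @[k --> \oo] --> B i j) ->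
  (forall k, (\rank (A k) <= r)%N) -> (\rank B <= r)%N.
Proof.
move=> AB rankA; rewrite leqNgt; apply/negP => ltr.
have [P [Q PBQ]] := mxrank_id B.
have det0 k : \det (P *m A k *m Q) = 0.
  apply/eqP; apply: contraTT ltr; rewrite -unitfE -unitmxE -leqNgt => /mxrank_unit <-.
  by rewrite (leq_trans _ (rankA k)) // (leq_trans (mxrankM_maxl _ _)) ?mxrankM_maxr.
have: \det (P *m A k *m Q) @[k --> \oo] --> \det (P *m B *m Q).
  apply: cvg_det; apply: cvg_mulmx => [|*]; last exact: cvg_cst.
  by apply: cvg_mulmx => // *; exact: cvg_cst.
under eq_cvg do rewrite det0; rewrite PBQ det1 => /cvg_lim lim1.
have := lim1 (@norm_hausdorff _ _); rewrite lim_cst; last exact: norm_hausdorff.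
by move/eqP; rewrite eq_sym oner_eq0.
Qed.

Lemma mxrank_sum m n (J : finType) (F : J -> 'M[K]_(m, n)) :
  (\rank (\sum_j F j)%R <= \sum_j \rank (F j))%N.
Proof.
elim/big_ind2: _ => [|x x' y y' le1 le2|//]; first by rewrite mxrank0.
by rewrite (leq_trans (mxrank_add _ _)) ?leq_add.
Qed.

End MatrixRank.

(** * Kronecker product of two linear maps to matrices *)

Section Kronecker.
Variables (K : numFieldType) (I J : finType) (U : I -> vectType K) (W : J -> vectType K).

Definition cat_index (x : tensor_index U) (y : tensor_index W) :
    tensor_index (fam_cat U W) :=
  [ffun k => match k return 'I_(\dim {:fam_cat U W k}) with
             | inl i => x i | inr j => y j end].

Lemma entry_pure_cat (u : forall k, fam_cat U W k) x y :
  entry (pure u) (cat_index x y) =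
  entry (pure (fun i => u (inl i) : U i)) x * entry (pure (fun j => u (inr j) : W j)) y.
Proof.
rewrite !entry_pure big_sumType /=.
by congr (_ * _); apply: eq_bigr => ? _; rewrite ffunE.
Qed.

Lemma entry_tprod (s : tensor U) (t : tensor W) x y :
  entry (tprod s t) (cat_index x y) = entry s x * entry t y.
Proof.
have entryZ (I' : finType) (U' : I' -> vectType K) a (r : tensor U') z :
  entry (a *: r) z = a * entry r z by rewrite /entry ffunE.
rewrite /tprod tliftE entry_sum (bigD1 x) //= big1 ?addr0 => [|x' neq]; last first.
  rewrite entryZ tliftE entry_sum big1 ?mulr0 // => y' _.
  by rewrite entryZ entry_pure_cat entry_pure_basis (negbTE neq) mul0r mulr0.
rewrite entryZ tliftE entry_sum (bigD1 y) //= big1 ?addr0 => [|y' neq]; last first.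
  by rewrite entryZ entry_pure_cat !entry_pure_basis (negbTE neq) !mulr0.
by rewrite entryZ entry_pure_cat !entry_pure_basis !eqxx !mulr1.
Qed.

Variables (m n p q : nat) (L : {linear tensor U -> 'M[K]_(m, n)})
  (L' : {linear tensor W -> 'M[K]_(p, q)}).

(** The extension by linearity of u (x) w |-> L u *t L' w, for simple tensors u and
    w, evaluated on the coordinates of [T]. *)
Definition kron_map (T : tensor (fam_cat U W)) : 'M[K]_(m * p, n * q) :=
  \sum_x \sum_y entry T (cat_index x y) *:
    (L (pure (basis_tuple x)) *t L' (pure (basis_tuple y))).

(** Stated through coordinates so that it covers both [tprod s t] and a simple tensor
    over the sum of the two families, which is not literally a [tprod]. *)
Lemma kron_mapE T s t :
  (forall x y, entry T (cat_index x y) = entry s x * entry t y) ->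
  kron_map T = L s *t L' t.
Proof.
move=> TE; rewrite [s in RHS]tensor_basis [t in RHS]tensor_basis !linear_sum.
apply/matrixP => i j; rewrite !mxE !summxE mulr_suml; apply: eq_bigr => x _.
rewrite summxE mulr_sumr; apply: eq_bigr => y _.
by rewrite TE !linearZ !mxE mulrACA.
Qed.

(** The general form of the bound: [L] and [L'] may be any linear maps whose values
    on simple tensors have bounded rank.  Subadditivity of rank bounds the images of
    the approximating tensors, and [mxrank_lim] passes to the limit. *)
Lemma border_rank_tprod a b (i0 : I) (s : tensor U) (t : tensor W) :
  (forall u, (\rank (L (pure u)) <= a)%N) -> (forall w, (\rank (L' (pure w)) <= b)%N) ->
  (\rank (L s) * \rank (L' t) <= border_rank (tprod s t) * (a * b))%N.
Proof.
move=> La Lb; have [T [rankT cvgT]] := border_rankP (tprod s t).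
rewrite -mxrank_tens -(kron_mapE (entry_tprod s t)).
apply: (@mxrank_lim _ _ _ (fun k => kron_map (T k))) => [i j | k].
  rewrite summxE; under eq_cvg do rewrite summxE.
  apply: (cvg_big (op := +%R)) => [|x _]; first exact: add_continuous.
  rewrite summxE; under eq_cvg do rewrite summxE.
  apply: (cvg_big (op := +%R)) => [|y _]; first exact: add_continuous.
  rewrite mxE; under eq_cvg do rewrite mxE.
  by apply: cvgM; [exact: cvgT | exact: cvg_cst].
move: (tensor_rank (T k)) (rankT k) (tensor_rankP (inl i0) (T k)) => r ler [u ->].
have -> : kron_map (\sum_l pure (u l)) = \sum_l kron_map (pure (u l)).
  rewrite /kron_map [RHS]exchange_big; apply: eq_bigr => x _.
  rewrite [RHS]exchange_big; apply: eq_bigr => y _.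
  by rewrite entry_sum scaler_suml.
rewrite (leq_trans (mxrank_sum _)) // (@leq_trans (\sum_(l < r) (a * b))) //.
  by apply: leq_sum => l _; rewrite (kron_mapE (entry_pure_cat _)) mxrank_tens leq_mul.
by rewrite sum_nat_const card_ord leq_mul.
Qed.

End Kronecker.

(** * Tensors with two and three factors *)

Local Notation i0 := (@Ordinal 3 0 isT).
Local Notation i1 := (@Ordinal 3 1 isT).
Local Notation i2 := (@Ordinal 3 2 isT).

Section SmallTensors.
Variable K : numFieldType.
Implicit Types U V W X Y : vectType K.

Definition pair_index U W (i : 'I_(\dim {:U})) (j : 'I_(\dim {:W})) :
    tensor_index (fam2 U W) :=
  [ffun b => if b return 'I_(\dim {:fam2 U W b}) then j else i].

Definition tens_mx U W (t : tens2 U W) : 'M[K]_(\dim {:U}, \dim {:W}) :=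
  \matrix_(i, j) entry t (pair_index i j).

Lemma tens_mx_linear U W : linear (@tens_mx U W).
Proof. by move=> a s t; apply/matrixP => i j; rewrite !mxE entry_lin. Qed.

HB.instance Definition _ U W := GRing.isLinear.Build K (tens2 U W)
  'M[K]_(\dim {:U}, \dim {:W}) _ (@tens_mx U W) (@tens_mx_linear U W).

Lemma tens_mx_inj U W : injective (@tens_mx U W).
Proof.
move=> s t /matrixP eq_st; apply/ffunP => x.
have -> : x = pair_index (x false) (x true) by apply/ffunP => -[]; rewrite ffunE.
by have := eq_st (x false) (x true); rewrite !mxE.
Qed.

Lemma tens_mx_pure2 U W (u : U) (w : W) i j :
  tens_mx (pure2 u w) i j = coord (vbasis {:U}) i u * coord (vbasis {:W}) j w.
Proof. by rewrite mxE entry_pure big_bool /= !ffunE mulrC. Qed.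

Lemma rank_tens_mx_pure2 U W (u : U) (w : W) : (\rank (tens_mx (pure2 u w)) <= 1)%N.
Proof.
have -> : tens_mx (pure2 u w) =
    (\col_i coord (vbasis {:U}) i u) *m (\row_j coord (vbasis {:W}) j w).
  by apply/matrixP => i j; rewrite tens_mx_pure2 mxE big_ord1 !mxE.
exact: mulmx_max_rank.
Qed.

(** The columns of [col_base] and the rows of [row_base] of the coordinate matrix are
    the coordinates of a shortest decomposition into simple tensors. *)
Lemma rank_tens_mx U W (t : tens2 U W) : \rank (tens_mx t) = tensor_rank t.
Proof.
apply/eqP; rewrite eqn_leq; apply/andP; split.
  have [u tu] := tensor_rankP true t.
  rewrite {1}tu linear_sum /= (leq_trans (mxrank_sum _)) //.
  rewrite -[leqRHS](card_ord (tensor_rank t)) -sum1_card; apply: leq_sum => k _.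
  have -> : pure (u k) = pure2 (u k false) (u k true).
    by congr pure; apply: functional_extensionality_dep => -[].
  exact: rank_tens_mx_pure2.
apply: tensor_rank_le.
pose C := col_base (tens_mx t); pose R := row_base (tens_mx t).
exists (fun k b => if b return fam2 U W b then \sum_j R k j *: (vbasis {:W})`_j
                   else \sum_i C i k *: (vbasis {:U})`_i).
apply: tens_mx_inj; rewrite linear_sum /= -[LHS]mulmx_base.
apply/matrixP => i j; rewrite summxE mxE; apply: eq_bigr => k _.
rewrite -[pure _]/(pure2 _ _) tens_mx_pure2.
by rewrite !coord_sum_free ?(basis_free (vbasisP _)).
Qed.

Lemma bilinear_multilinear U W X (f : U -> W -> X) :
  (forall w, linear (f^~ w)) -> (forall u, linear (f u)) ->
  multilinear (fun u : forall b, fam2 U W b => f (u false) (u true)).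
Proof.
by move=> fl fr u [] a v w; rewrite !dfwith_in !dfwith_out //; [exact: fr | exact: fl].
Qed.

Lemma tlift2_pure U W X (f : U -> W -> X) u w :
  (forall w, linear (f^~ w)) -> (forall u, linear (f u)) ->
  tlift2 f (pure2 u w) = f u w.
Proof. by move=> fl fr; rewrite /tlift2 tlift_pure //; exact: bilinear_multilinear. Qed.

Lemma pure2_linearl U W (w : W) : linear (fun u : U => pure2 u w).
Proof.
move=> a u u'; apply: tens_mx_inj; apply/matrixP => i j.
transitivity (a * tens_mx (pure2 u w) i j + tens_mx (pure2 u' w) i j).
  by rewrite !tens_mx_pure2 linearP /= mulrDl mulrA.
by rewrite !mxE entry_lin.
Qed.

Lemma pure2_linearr U W (u : U) : linear (fun w : W => pure2 u w).
Proof.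
move=> a w w'; apply: tens_mx_inj; apply/matrixP => i j.
transitivity (a * tens_mx (pure2 u w) i j + tens_mx (pure2 u w') i j).
  by rewrite !tens_mx_pure2 linearP /= mulrDr mulrCA.
by rewrite !mxE entry_lin.
Qed.

Lemma trilinear_multilinear U V W X (f : U -> V -> W -> X) :
  (forall v w, linear (fun u => f u v w)) -> (forall u w, linear (fun v => f u v w)) ->
  (forall u v, linear (f u v)) ->
  multilinear (fun u : forall i, fam3 U V W i => f (u i0) (u i1) (u i2)).
Proof.
move=> f1 f2 f3 u [[|[|[|//]]] lti] a v w; rewrite (bool_irrelevance lti isT) in v w *.
- by rewrite !dfwith_in !dfwith_out //; exact: f1.
- by rewrite !dfwith_in !dfwith_out //; exact: f2.
- by rewrite !dfwith_in !dfwith_out //; exact: f3.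
Qed.

Variables (V1 V2 V3 A B : vectType K) (phi : V2 -> tens2 A B).
Hypothesis phi_linear : linear phi.

Lemma young_flattening_pure (u : forall i, fam3 V1 V2 V3 i) :
  young_flattening V1 V3 phi (pure u) =
  tlift2 (fun a b => pure2 (pure2 (u i0) a) (pure2 b (u i2))) (phi (u i1)).
Proof.
rewrite /young_flattening /tlift3 tlift_pure //.
apply: (trilinear_multilinear (f := fun v1 v2 v3 =>
   tlift2 (fun a b => pure2 (pure2 v1 a) (pure2 b v3)) (phi v2))).
- by move=> v w a x y; apply: tlift_linear => z; rewrite !pure2_linearl.
- by move=> v w a x y; rewrite phi_linear linearP.
- by move=> v w a x y; apply: tlift_linear => z; rewrite !pure2_linearr.
Qed.

(** A decomposition of [phi v2] into r simple tensors a (x) b gives the decomposition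
    of the flattening into the r simple tensors (v1 (x) a) (x) (b (x) v3). *)
Lemma tensor_rank_flattening (u : forall i, fam3 V1 V2 V3 i) :
  (tensor_rank (young_flattening V1 V3 phi (pure u)) <= tensor_rank (phi (u i1)))%N.
Proof.
rewrite young_flattening_pure; apply: tensor_rank_le.
set y := phi _; move: (tensor_rank y) (tensor_rankP true y) => r [v ->].
exists (fun k b => if b return fam2 (tens2 V1 A) (tens2 B V3) b
  then pure2 (v k true) (u i2) else pure2 (u i0) (v k false)).
rewrite linear_sum /=; apply: eq_bigr => k _.
have -> : pure (v k) = pure2 (v k false) (v k true).
  by congr pure; apply: functional_extensionality_dep => -[].
rewrite tlift2_pure // => w a z z'.
- by rewrite pure2_linearr pure2_linearl.
- by rewrite pure2_linearl pure2_linearr.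
Qed.

(** The maximum exists because the rank of a tensor is at most the number of its
    coordinates. *)
Lemma tensor_rank_le_greatest v :
  (tensor_rank (phi v) <= greatest [set tensor_rank (phi v) | v in [set: V2]])%N.
Proof.
apply: (@greatest_ge _ #|tensor_index (fam2 A B)|); last by exists v.
by move=> _ [w _ <-]; apply/tensor_rank_le/(has_length_card true).
Qed.

End SmallTensors.

(** * Pieri maps *)

Lemma pieri_map_linear (K : numFieldType) (V : vectType K) la mu
    (iota : 'Hom(schur V mu, tens2 V (schur V la))) :
  linear (pieri_map iota).
Proof.
move=> a v w; rewrite /pieri_map /hom_tensor scaler_sumr -big_split /=; apply: eq_bigr => i _.
rewrite !comp_lfunE -pure2_linearr; congr pure2.
apply: tlift_linear => u.
by rewrite add_lfunE scale_lfunE scalerDl scalerA.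
Qed.

Theorem proposition21 (R : realType) (V1 V2 V3 W1 W2 W3 : vectType R[i])
  (s : tens3 V1 (dual V2) V3) (t : tens3 W1 (dual W2) W3)
  (la mu ka nu : seq nat)
  (part_la : is_partition la) (part_mu : is_partition mu)
  (size_la : (size la <= \dim {:V2})%N) (size_mu : (size mu <= \dim {:V2})%N)
  (box_mu : add_box la mu)
  (part_ka : is_partition ka) (part_nu : is_partition nu)
  (size_ka : (size ka <= \dim {:W2})%N) (size_nu : (size nu <= \dim {:W2})%N)
  (box_nu : add_box ka nu)
  (iota : 'Hom(schur V2 mu, tens2 V2 (schur V2 la)))
  (iota_emb : pieri_embedding iota)
  (eta : 'Hom(schur W2 nu, tens2 W2 (schur W2 ka)))
  (eta_emb : pieri_embedding eta) :
  let phi := pieri_map iota in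
  let psi := pieri_map eta in
  (tensor_rank (young_flattening V1 V3 phi s))%:R
    / (greatest [set tensor_rank (phi v) | v in [set: dual V2]])%:R
  * ((tensor_rank (young_flattening W1 W3 psi t))%:R
    / (greatest [set tensor_rank (psi w) | w in [set: dual W2]])%:R)
  <= (border_rank (tprod s t))%:R :> R.
Proof.
cbv zeta; set phi := pieri_map iota; set psi := pieri_map eta.
have phi_lin : linear phi := pieri_map_linear iota.
have psi_lin : linear psi := pieri_map_linear eta.
set F := young_flattening V1 V3 phi; set G := young_flattening W1 W3 psi.
set a := greatest _; set b := greatest _.
have main : (tensor_rank (F s) * tensor_rank (G t)
    <= border_rank (tprod s t) * (a * b))%N.
  rewrite -!rank_tens_mx.
  apply: (border_rank_tprod (L := @tens_mx _ _ _ \o F)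
                            (L' := @tens_mx _ _ _ \o G)) => [|u|u].
  - exact: i0.
  - by rewrite /= rank_tens_mx (leq_trans (tensor_rank_flattening phi_lin u))
      ?tensor_rank_le_greatest.
  - by rewrite /= rank_tens_mx (leq_trans (tensor_rank_flattening psi_lin u))
      ?tensor_rank_le_greatest.
have [->|a_gt0] := posnP a; first by rewrite invr0 mulr0 mul0r ler0n.
have [->|b_gt0] := posnP b; first by rewrite invr0 !mulr0 ler0n.
by rewrite mulf_div -!natrM ler_pdivrMr ?ltr0n ?muln_gt0 ?a_gt0 // -natrM ler_nat.
Qed.
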